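(* Let $p,r$ be positive integers and $k$ a positive integer. Then the number $T_{p,r}(k)$ of distinct coral diagrams of type $(p,r)$ with precisely $k$ $p$-stars equals the Raney number $R_{p,r}(k)$: $$T_{p,r}(k) = R_{p,r}(k) = \binom{pk+r-1}{k-1}\frac{r}{k}.$$
   Context: The Raney numbers are $R_{p,r}(n) = \frac{r}{np+r}\binom{np+r}{n}$. A $p$-star is a rooted tree consisting of a single base vertex with $p$ terminal edges lying above it. A coral diagram of type $(p,r)$ is a planar rooted tree obtained as follows: start from a base vertex with $r+1$ terminal edges, ordered left to right; then repeatedly choose a terminal vertex that is not the endpoint of the leftmost edge adjacent to the base vertex, and attach a $p$-star there by identifying the star's base vertex with that terminal vertex. Equivalently, it is a plane (ordered) rooted tree in which the root has exactly $r+1$ ordered children, the leftmost child of the root is a leaf, and every other non-leaf, non-root vertex has exactly $p$ ordered children; the number of $p$-stars is the number of non-root, non-leaf vertices. Two coral diagrams are the same if they are isomorphic as plane rooted trees. $T_{p,r}(k)$ denotes the number of distinct coral diagrams of type $(p,r)$ with exactly $k$ $p$-stars. *)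

(* Defs.v *)
From HB Require Import structures.
From mathcomp Require Import all_boot all_order all_algebra finmap.
From mathcomp Require Import boolp classical_sets functions cardinality.
Set Implicit Arguments.
Unset Strict Implicit.
Unset Printing Implicit Defensive.
Import GRing.Theory.

(** Plane rooted trees: a vertex is the ordered list of the subtrees above it,
    so that isomorphism of plane rooted trees is Leibniz equality. *)
Inductive plane_tree : Type := Node of seq plane_tree.

Definition children (t : plane_tree) : seq plane_tree :=
  let: Node s := t in s.

Definition leaf : plane_tree := Node [::].

Definition star (p : nat) : plane_tree := Node (nseq p leaf).

Fixpoint tree_encode (t : plane_tree) : GenTree.tree void :=
  let: Node s := t in GenTree.Node 0 (map tree_encode s).

Fixpoint tree_decode (e : GenTree.tree void) : plane_tree :=
  if e is GenTree.Node _ s then Node (map tree_decode s) else leaf.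

Lemma tree_encodeK : cancel tree_encode tree_decode.
Proof.
rewrite /cancel; fix IH 1; case=> s /=; congr Node.
by elim: s => [|t s IHs] //=; rewrite IH IHs.
Qed.

HB.instance Definition _ := Countable.copy plane_tree (can_type tree_encodeK).

(** A vertex is addressed by the list of child indices (counted from 0, left to
    right) on the path from the root to it; [subtree t w] is [None] when [w]
    is not the address of a vertex of [t]. *)
Fixpoint subtree (t : plane_tree) (w : seq nat) : option plane_tree :=
  if w is i :: w' then obind (subtree^~ w') (onth (children t) i) else Some t.

Definition terminal (t : plane_tree) (w : seq nat) : Prop :=
  subtree t w = Some leaf.

(** [graft t w u] replaces the subtree of [t] at [w] by [u]; it is meaningful
    only when [w] is the address of a vertex of [t]. *)
Fixpoint graft (t : plane_tree) (w : seq nat) (u : plane_tree) : plane_tree :=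
  if w is i :: w' then
    Node (set_nth leaf (children t) i (graft (nth leaf (children t) i) w' u))
  else u.

(** The address [[:: 0]] is the endpoint of the leftmost edge at the base. *)
Inductive coral_diagram (p r : nat) : plane_tree -> Prop :=
| coral_base : coral_diagram p r (star r.+1)
| coral_attach (t : plane_tree) (w : seq nat) :
    coral_diagram p r t -> terminal t w -> w <> [:: 0] ->
    coral_diagram p r (graft t w (star p)).

Fixpoint nb_inner (t : plane_tree) : nat :=
  let: Node s := t in
  if s is [::] then 0 else (sumn (map nb_inner s)).+1.

(** The p-stars correspond to the vertices that are neither the root nor a
    leaf (for p > 0). *)
Definition nb_stars (t : plane_tree) : nat := sumn (map nb_inner (children t)).

Definition coral_set (p r k : nat) : set plane_tree :=
  [set t | coral_diagram p r t /\ nb_stars t = k]%classic.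

(** [fset_set] sends an infinite set to the empty one; an equation
    [coral_count p r k = n] with n > 0 thus entails finiteness. *)
Definition coral_count (p r k : nat) : nat :=
  #|` fset_set (coral_set p r k)|%fset.

Definition raney (p r n : nat) : rat :=
  (r%:R / (n * p + r)%:R * 'C(n * p + r, n)%:R)%R.

(* Main.v *)
(** A coral diagram is a root whose first child is a leaf, followed by an
    ordered forest of [r] trees in which every vertex has 0 or [p] children.
    Deleting the root of the first tree of such a forest gives
      [F (r+1, k) = F (r, k) + F (r+p, k-1)]
    for the number [F (r, k)] of forests with [k] inner vertices, and
    [(pk+r) F (r, k) = r 'C(pk+r, k)] follows by induction. *)
Require Import Defs.
From mathcomp Require Import all_boot all_order all_algebra.
From mathcomp Require Import finmap classical_sets cardinality.
From mathcomp Require Import ring.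
Import GRing.Theory.

(** Induction through the nested list: the hypothesis is available for every child. *)
Lemma plane_tree_mem_ind (P : plane_tree -> Prop) :
  (forall s, (forall u, u \in s -> P u) -> P (Node s)) -> forall t, P t.
Proof.
move=> H; fix IH 1; case=> s; apply: H.
(* [IH] is cleared so that the empty case is not closed by an unguarded recursive call. *)
elim: s => [|t s IHs] u; first by clear IH.
rewrite inE => /orP[/eqP ->|]; [exact: IH|exact: IHs].
Qed.

Lemma nb_inner_eq0 (t : plane_tree) : (nb_inner t == 0) = (t == leaf).
Proof. by case: t => -[|u s]; rewrite ?eqxx //=; apply/esym/negP => /eqP. Qed.

Fixpoint full_tree (p : nat) (t : plane_tree) : bool :=
  let: Node s := t in ((s == [::]) || (size s == p)) && all (full_tree p) s.

Lemma onth_set_nth (T : Type) (x0 : T) (s : seq T) (i : nat) (x : T) :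
  onth (set_nth x0 s i x) i = Some x.
Proof. by elim: i s => [|i IHi] [|y s] //=; rewrite ?IHi //; elim: i {IHi}. Qed.

Lemma subtree_graft (t u : plane_tree) (w v : seq nat) :
  subtree (graft t w u) (w ++ v) = subtree u v.
Proof. by elim: w t => [//|i w IHw] t /=; rewrite onth_set_nth /= IHw. Qed.

Lemma graft_graft (t u u' : plane_tree) (w v : seq nat) :
  graft (graft t w u) (w ++ v) u' = graft t w (graft u v u').
Proof.
elim: w t => [//|i w IHw] t /=.
by rewrite set_set_nth eqxx nth_set_nth /= eqxx IHw.
Qed.

Lemma graft_leaf (t : plane_tree) (w : seq nat) :
  terminal t w -> graft t w leaf = t.
Proof.
rewrite /terminal; elim: w t => [t [->] //|i w IHw] [s] /=.
case E: (onth s i) => [u|//] /= /IHw Hu; congr Node.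
elim: s i E => [|x s IHs] [|i] //=; first by case=> ->; rewrite Hu.
by move/IHs ->.
Qed.

Lemma full_tree_leaves (p n : nat) : all (full_tree p) (nseq n leaf).
Proof. by rewrite all_nseq orbT. Qed.

Lemma full_star (p : nat) : full_tree p (star p).
Proof. by rewrite /= size_nseq eqxx orbT full_tree_leaves. Qed.

(** Stated for forests so that induction on the address applies to the children of each vertex on
    the path; the size is carried along because it is the arity of that vertex. *)
Lemma full_forest_graft (p i : nat) (w : seq nat) (s : seq plane_tree) :
  subtree (Node s) (i :: w) = Some leaf -> all (full_tree p) s ->
  let s' := set_nth leaf s i (graft (nth leaf s i) w (star p)) in
  size s' = size s /\ all (full_tree p) s'.
Proof.
elim: w i s => [|j w IHw] i s.
  rewrite /=; elim: s i => [|x s IHs] [|i] //= Hx /andP[fx fs].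
    by split=> //; rewrite fs andbT; exact: full_star.
  by have [-> ->] := IHs i Hx fs; rewrite fx.
elim: s i => [|[v] s IHs] [|i] // Hx /= /andP[fx fs].
  have [/= -> ->] := IHw j v Hx (proj2 (andP fx)).
  rewrite fs andbT; split=> //; case/andP: fx => /orP[/eqP ve|->] _.
    by rewrite ve in Hx; case: (j) Hx.
  by rewrite orbT.
by have [-> ->] := IHs i Hx fs; rewrite fx.
Qed.

Lemma coral_diagram_shape (p r : nat) (t : plane_tree) :
  coral_diagram p r t ->
  exists2 s, t = Node (leaf :: s) & (size s = r) /\ all (full_tree p) s.
Proof.
elim=> {t} [|t w _ [s -> [sz fs]]].
  by exists (nseq r leaf); rewrite ?size_nseq ?full_tree_leaves.
(* The root is not a leaf, and the only address through the first child is the forbidden [[:: 0]];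
   the star thus lands in the forest. *)
case: w => [//|[|i] w] Ht w0.
  by case: w Ht w0 => [|[|j] w].
have [szE ?] := full_forest_graft p i w s Ht fs.
by eexists; first reflexivity; rewrite szE.
Qed.

(** The leaves are replaced from left to right, [pre] being the part already done. The next position
    is [w ++ [:: size pre]], and positivity keeps it different from [[:: 0]]. *)
Lemma coral_graft_forest (p r : nat) (t : plane_tree) (w : seq nat)
    (pre s : seq plane_tree) :
  (forall u, u \in s -> forall t' w', coral_diagram p r t' ->
     terminal t' w' -> w' <> [:: 0] -> coral_diagram p r (graft t' w' u)) ->
  0 < size w + size pre ->
  coral_diagram p r (graft t w (Node (pre ++ nseq (size s) leaf))) ->
  coral_diagram p r (graft t w (Node (pre ++ s))).
Proof.
elim: s pre => [//|u s IHs] pre Hs Hpos Ht; rewrite -cat_rcons.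
apply: IHs => [v vs| |]; first by apply: Hs; rewrite inE vs orbT.
  by rewrite size_rcons addnS.
suff -> : graft t w (Node (rcons pre u ++ nseq (size s) leaf)) =
    graft (graft t w (Node (pre ++ nseq (size s).+1 leaf))) (w ++ [:: size pre]) u.
  apply: Hs => //; first by rewrite inE eqxx.
    rewrite /terminal subtree_graft /=.
    by elim: pre {Hpos Ht}.
  by case: w Hpos {Ht} => [|? []] //=; case: (size pre).
rewrite graft_graft /=; congr (graft t w (Node _)).
by elim: pre {Hpos Ht} => [|v pre /= ->].
Qed.

(** A nontrivial full tree grows from its root: attach a star, then graft the children onto its [p]
    leaves. *)
Lemma coral_graft_full (p r : nat) (u : plane_tree) :
  full_tree p u -> forall (t : plane_tree) (w : seq nat), coral_diagram p r t ->
  terminal t w -> w <> [:: 0] -> coral_diagram p r (graft t w u).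
Proof.
elim/plane_tree_mem_ind: u => s IHs /= /andP[/orP[/eqP ->|/eqP sz] fs] t w Ct tw w0.
  by rewrite graft_leaf.
rewrite -[s]cat0s; apply: coral_graft_forest.
- by move=> u us; apply: IHs => //; exact: (allP fs).
- by case: w tw w0 => // t0; have [v tE _] := coral_diagram_shape _ _ _ Ct; rewrite tE in t0.
- by rewrite sz; exact: coral_attach.
Qed.

Lemma coral_of_full_forest (p : nat) (s : seq plane_tree) :
  all (full_tree p) s -> coral_diagram p (size s) (Node (leaf :: s)).
Proof.
move=> /allP fs.
(* Grafting at the root discards the old tree, here [leaf]; the initial [pre] is the leftmost child,
   which stays a leaf. *)
apply: (coral_graft_forest p (size s) leaf [::] [:: leaf] s) => // [u us|].
  by apply: coral_graft_full; exact: fs.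
exact: coral_base.
Qed.

(** The nested [fix] gives lexicographic recursion on [(k, r)]: the number of trees may grow to
    [p + r'] once [k] drops. The first [p] trees become the children of a new root. *)
Fixpoint full_forests (p k : nat) : nat -> seq (seq plane_tree) :=
  if k is k'.+1 then
    fix F (r : nat) : seq (seq plane_tree) :=
      if r is r'.+1 then
        [seq leaf :: s | s <- F r'] ++
        [seq Node (take p s) :: drop p s | s <- full_forests p k' (p + r')]
      else [::]
  else fun r => [:: nseq r leaf].

Lemma full_forestsSS (p k r : nat) :
  full_forests p k.+1 r.+1 =
    [seq leaf :: s | s <- full_forests p k.+1 r] ++
    [seq Node (take p s) :: drop p s | s <- full_forests p k (p + r)].
Proof. by []. Qed.

Lemma mem_full_forests (p k r : nat) (s : seq plane_tree) : 0 < p ->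
  (s \in full_forests p k r) =
    [&& size s == r, all (full_tree p) s & sumn (map nb_inner s) == k].
Proof.
move=> p0; elim: k r s => [|k IHk] r s.
  rewrite inE; elim: s r => [|u s IHs] [|r] //.
  rewrite /= eqseq_cons IHs eqSS addn_eq0 nb_inner_eq0.
  by case: eqP => [->|_] /=; rewrite ?andbF.
elim: r s => [|r IHr] s; first by case: s.
rewrite full_forestsSS mem_cat; case: s => [|[v] s].
  by apply/negP => /orP[] /mapP[].
have -> : (Node v :: s \in [seq leaf :: s | s <- full_forests p k.+1 r]) =
    (v == [::]) && (s \in full_forests p k.+1 r).
  apply/mapP/andP => [[x xF [-> ->]] //|[/eqP -> sF]]; by exists s.
have -> : (Node v :: s \in
    [seq Node (take p s) :: drop p s | s <- full_forests p k (p + r)]) =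
    (size v == p) && (v ++ s \in full_forests p k (p + r)).
  apply/mapP/andP => [[x xF [-> ->]]|[/eqP sz vsF]].
    rewrite cat_take_drop; split=> //; move: xF; rewrite IHk => /and3P[/eqP sz _ _].
    by rewrite size_takel // sz leq_addr.
  by exists (v ++ s); rewrite // -sz take_size_cat // drop_size_cat.
rewrite IHr IHk /= eqSS size_cat all_cat map_cat sumn_cat.
case: v => [|u v] /=; first by rewrite (ltn_eqF p0) orbF.
case: eqP => [->|] /=; last by rewrite andbF.
by rewrite eqn_add2l addSn eqSS -!andbA.
Qed.

Lemma full_forests_uniq (p k r : nat) : 0 < p -> uniq (full_forests p k r).
Proof.
move=> p0; elim: k r => [//|k IHk]; elim=> [//|r IHr].
rewrite full_forestsSS cat_uniq !map_inj_uniq ?IHr ?IHk ?andbT /=.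
(* The two lists are disjoint: a common element would give [take p x] empty, hence [p = 0]. *)
- apply/hasPn => _ /mapP[x xF ->]; apply/mapP => -[y _ [tx _]].
  move: xF; rewrite mem_full_forests // => /andP[/eqP sz _].
  by have := congr1 size tx; rewrite size_takel ?sz ?leq_addr //= => p00; rewrite p00 in p0.
- by move=> x y [Et Ed]; rewrite -[x](cat_take_drop p) Et Ed cat_take_drop.
- by move=> x y [].
Qed.

Lemma size_full_forests (p k r : nat) : 0 < p ->
  (p * k + r) * size (full_forests p k r) = r * 'C(p * k + r, k).
Proof.
move=> p0; elim: k r => [|k IHk] r; first by rewrite muln0 bin0.
elim: r => [|r IHr]; first by rewrite muln0.
rewrite full_forestsSS size_cat !size_map addnS.
(* Both recursive terms share the same [N], since [p * k + (p + r) = p * k.+1 + r]. *)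
have := IHk (p + r); rewrite addnA -mulnSr => {}IHk.
have N0 : 0 < p * k.+1 + r by rewrite addn_gt0 muln_gt0 p0.
have := mul_bin_diag (p * k.+1 + r).+1 k; rewrite binS /=.
move: IHr IHk; set N := p * k.+1 + r; set X := size _; set Y := size _.
set a := 'C(N, k.+1); set b := 'C(N, k) => HX HY Hab.
(* The hypotheses only give [N * X] and [N * Y], so the goal is multiplied by [N]. *)
apply/eqP; rewrite -(eqn_pmul2l N0) -/N; apply/eqP.
transitivity (N.+1 * (N * X + N * Y)); first by ring.
rewrite HX HY.
transitivity (r * N.+1 * (a + b) + p * (N.+1 * b)); first by ring.
by rewrite Hab /N; ring.
Qed.

Lemma coral_count_forests (p r k : nat) : 0 < p ->
  coral_count p r k = size (full_forests p k r).
Proof.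
move=> p0; rewrite /coral_count.
set c := [seq Node (leaf :: s) | s <- full_forests p k r].
(* An explicit finite set rules out the default value of [fset_set]. *)
have -> : coral_set p r k = [set` [fset t in c]%fset]%classic.
  apply/seteqP; split=> t /=; rewrite in_fset /=.
    move=> [/coral_diagram_shape[s -> [sz fs]] nk]; apply/mapP; exists s => //.
    by rewrite mem_full_forests // sz fs -nk !eqxx.
  move=> /mapP[s]; rewrite mem_full_forests // => /and3P[/eqP <- fs /eqP <-] ->.
  by split; [exact: coral_of_full_forest|].
rewrite set_fsetK card_fseq undup_id ?size_map //.
by rewrite map_inj_uniq ?full_forests_uniq // => x y [].
Qed.

Theorem theorem2p5 (p r k : nat) (hp : 0 < p) (hr : 0 < r) (hk : 0 < k) :
  ((coral_count p r k)%:R = raney p r k)%R /\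
  (raney p r k = 'C(p * k + r - 1, k - 1)%:R * (r%:R / k%:R))%R.
Proof.
have N0 : 0 < p * k + r by rewrite addn_gt0 hr orbT.
have NQ : ((p * k + r)%:R != 0 :> rat)%R by rewrite Num.Theory.pnatr_eq0 -lt0n.
have kQ : (k%:R != 0 :> rat)%R by rewrite Num.Theory.pnatr_eq0 -lt0n.
rewrite /raney [k * p]mulnC coral_count_forests //; split.
  apply: (mulfI NQ); rewrite -natrM size_full_forests // natrM.
  by rewrite mulrA mulrCA divff // mulr1.
(* Absorption identity; both truncated subtractions are exact by positivity. *)
have : (p * k + r) * 'C(p * k + r - 1, k - 1) = k * 'C(p * k + r, k).
  by rewrite !subn1 -{1 3}(prednK N0) mul_bin_diag !prednK.
move/(congr1 (fun n => n%:R : rat)%R); rewrite !natrM => H.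
have -> : ('C(p * k + r, k)%:R =
    (p * k + r)%:R * 'C(p * k + r - 1, k - 1)%:R / k%:R :> rat)%R.
  by apply: (canRL (mulfK kQ)); rewrite mulrC H.
by rewrite mulrA [RHS]mulrA [('C(_, _)%:R * _)%R]mulrC mulrA divfK.
Qed.
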